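(* Let $F$ be a forest of order $n$ with no isolated vertex and with total domination number $\gamma_t$. Then the number $\sharp\gamma_t(F)$ of minimum total dominating sets of $F$ satisfies $$\sharp\gamma_t(F) \leq (1+\sqrt{2})^{n-\gamma_t},$$ with equality if and only if every component of $F$ is $K_2$ (the complete graph on two vertices).
   Context: Graphs are finite, simple, undirected, and have at least one vertex; the order of a graph is its number of vertices; a forest is an acyclic graph. A set $D$ of vertices of a graph $G$ is a total dominating set of $G$ if every vertex of $G$ (including those in $D$) has a neighbor in $D$. The total domination number $\gamma_t(G)$ is the minimum cardinality of a total dominating set of $G$ (one exists when $G$ has no isolated vertex). A minimum total dominating set is a total dominating set of cardinality $\gamma_t(G)$, and $\sharp\gamma_t(G)$ denotes the number of minimum total dominating sets of $G$. *)

(* Defs.v *)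
From mathcomp Require Import all_boot all_order all_algebra.

Set Implicit Arguments.
Unset Strict Implicit.
Unset Printing Implicit Defensive.

(* A simple graph on the vertex set T is an edge relation e : rel T that is
   symmetric and irreflexive; these two properties are hypotheses of the
   statements that use the definitions below. *)
Section Graphs.

Variables (T : finType) (e : rel T).

Definition no_isolated_vertex : Prop := forall x : T, exists y : T, e x y.

(* MathComp's ucycle also accepts the degenerate sequences [::] and, for a
   symmetric e, the traversal [:: x; y] of a single edge back and forth; the
   cycles of a simple graph are the ones of length at least 3. *)
Definition acyclic : Prop := forall c : seq T, 2 < size c -> ~ ucycle e c.

Definition total_dominating (D : {set T}) : bool :=
  [forall x, [exists y in D, e x y]].

(* If the graph has no isolated vertex then [set: T] is total dominating, so
   this is the minimum cardinality of a total dominating set; otherwise there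
   is no such set and the value is meaningless. *)
Definition gamma_t : nat :=
  #|[arg min_(D < [set: T] | total_dominating D) #|D| ]%N|.

Definition min_total_dominating (D : {set T}) : bool :=
  total_dominating D && (#|D| == gamma_t).

Definition num_gamma_t : nat := #|[set D : {set T} | min_total_dominating D]|.

(* The vertex sets of the connected components; connect e is an equivalence
   relation because e is symmetric. *)
Definition components : {set {set T}} :=
  equivalence_partition (connect e) [set: T].

(* The subgraph induced by C is a complete graph on k vertices. *)
Definition induces_complete (k : nat) (C : {set T}) : Prop :=
  #|C| = k /\ {in C &, forall x y, x != y -> e x y}.

End Graphs.

(* Main.v *)
Require Import Defs.
From mathcomp Require Import all_boot all_order all_algebra.

Set Implicit Arguments.
Unset Strict Implicit.
Unset Printing Implicit Defensive.

Import Order.TTheory GRing.Theory Num.Theory.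
Local Open Scope ring_scope.

(** An open packing is a set of vertices with pairwise disjoint open
    neighbourhoods.  Every total dominating set meets each neighbourhood N(p),
    p in an open packing P, so it has at least #|P| vertices, and if it has
    exactly #|P| vertices then it consists of one vertex chosen in each N(p).

    In a forest without isolated vertices the two parameters agree: some open
    packing P has #|P| = gamma_t (lemma [open_packing_duality]).  It is built
    greedily, and acyclicity is what provides, at each step, a vertex w still
    to be dominated and a neighbour u of w that dominates every remaining
    vertex whose neighbourhood meets N(w) (lemma [forest_greedy_choice]).

    Hence the number of minimum total dominating sets is at most the product
    of the #|N(p)|, p in P.  As k <= 2 ^ (k - 1) and the N(p) are disjoint,
    this product is at most 2 ^ (n - gamma_t), which is stronger than the
    bound (1 + sqrt 2) ^ (n - gamma_t), and strictly so unless gamma_t = n.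
    Finally, gamma_t = n means that no vertex can be removed from the full
    vertex set, so every vertex has a neighbour of degree one; this forces all
    components to be K_2. *)

Local Open Scope nat_scope.

Definition open_packing (T : finType) (e : rel T) (P : {set T}) : Prop :=
  {in P &, forall p q x, e p x -> e q x -> p = q}.

(** * Total dominating sets *)

Lemma total_dominatingP (T : finType) (e : rel T) (D : {set T}) :
  reflect (forall x, exists2 y, y \in D & e x y) (total_dominating e D).
Proof. exact: 'forall_exists_inP. Qed.

Lemma total_dominating_setT (T : finType) (e : rel T) :
  no_isolated_vertex e -> total_dominating e [set: T].
Proof.
move=> noiso; apply/total_dominatingP => x.
by have [y exy] := noiso x; exists y.
Qed.

Lemma gamma_t_le (T : finType) (e : rel T) (D : {set T}) :
  no_isolated_vertex e -> total_dominating e D -> gamma_t e <= #|D|.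
Proof.
move=> /total_dominating_setT tdT tdD; rewrite /gamma_t.
by case: arg_minnP => // D0 _; apply.
Qed.

Lemma gamma_t_attained (T : finType) (e : rel T) :
  no_isolated_vertex e -> exists D, min_total_dominating e D.
Proof.
move=> /total_dominating_setT tdT.
exists [arg min_(D < [set: T] | total_dominating e D) #|D| ].
by rewrite /min_total_dominating /gamma_t eqxx andbT; case: arg_minnP.
Qed.

Lemma num_gamma_t_gt0 (T : finType) (e : rel T) :
  no_isolated_vertex e -> 0 < num_gamma_t e.
Proof.
by move=> /gamma_t_attained[D minD]; apply/card_gt0P; exists D; rewrite inE.
Qed.

(** * Open packings in forests *)

(** If y were on the path beyond b, then the segment of the path from a to y
    and the edge between y and a would form a cycle. *)
Lemma acyclic_path_extend (T : finType) (e : rel T) (a b y : T) (s : seq T) :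
  symmetric e -> irreflexive e -> acyclic e ->
  path e a (b :: s) -> uniq [:: a, b & s] -> e a y -> y != b ->
  path e y [:: a, b & s] && uniq [:: y, a, b & s].
Proof.
move=> e_sym e_irr acyc pth unq eay yb.
rewrite cons_uniq unq andbT; apply/andP; split.
  by move: pth; rewrite /= (e_sym y) eay.
rewrite !inE (negbTE yb) /=; apply/norP; split.
  by apply: contraTneq eay => ->; rewrite e_irr.
apply/negP => ys; case/splitPr: ys pth unq => s1 s2 pth unq.
apply: (acyc [:: a, b & rcons s1 y]); first by rewrite /= size_rcons.
move: pth unq; rewrite -cat_rcons -!cat_cons cat_uniq cat_path.
move=> /andP[pth _] /andP[unq _]; rewrite /ucycle unq andbT.
by rewrite /cycle rcons_path pth /= last_rcons e_sym.
Qed.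

(** If every neighbour u of every w in W missed some w' in W at distance two
    from w, then w' would be reached from w through a vertex other than u, and
    a path ending in u, w could be prolonged by two vertices, forever. *)
Lemma forest_greedy_choice (T : finType) (e : rel T) (W : {set T}) :
  symmetric e -> irreflexive e -> acyclic e -> no_isolated_vertex e ->
  W != set0 ->
  exists w u, [/\ w \in W, e w u &
    forall w' x, w' \in W -> e w x -> e w' x -> e w' u].
Proof.
move=> e_sym e_irr acyc noiso /set0Pn[w0 w0W].
pose good w u := [forall w' in W, [exists x, e w x && e w' x] ==> e w' u].
case: (boolP [exists w in W, [exists u, e w u && good w u]]).
  case/exists_inP=> w wW /existsP[u /andP[ewu /forall_inP gd]].
  exists w, u; split=> // w' x w'W ewx ew'x.
  by apply: (implyP (gd _ w'W)); apply/existsP; exists x; rewrite ewx.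
move=> /exists_inPn bad.
have long n : exists w u s,
    [/\ w \in W, path e w (u :: s), uniq [:: w, u & s] & n <= size s].
  elim: n => [|n [w [u [s [wW pth unq lens]]]]].
    have [u0 ew0u0] := noiso w0; exists w0, u0, [::]; split=> //=.
      by rewrite ew0u0.
    by rewrite inE andbT; apply: contraTneq ew0u0 => <-; rewrite e_irr.
  have ewu : e w u by case/andP: pth.
  have := bad _ wW => /existsPn/(_ u); rewrite ewu /= negb_forall.
  case/existsP=> w'; rewrite !negb_imply.
  case/and3P=> w'W /existsP[x /andP[ewx ew'x]] ew'uN.
  have xu : x != u by apply: contraNneq ew'uN => <-.
  have w'w : w' != w by apply: contraNneq ew'uN => ->.
  have /andP[pth1 unq1] := acyclic_path_extend e_sym e_irr acyc pth unq ewx xu.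
  rewrite e_sym in ew'x.
  have /andP[pth2 unq2] :=
    acyclic_path_extend e_sym e_irr acyc pth1 unq1 ew'x w'w.
  by exists w', x, [:: w, u & s]; split=> //=; apply: ltnW.
have [w [u [s [_ _ unq lens]]]] := long #|T|.
have := max_card [in [:: w, u & s]]; rewrite (card_uniqP unq) /= => /ltnW.
by rewrite leqNgt ltnS lens.
Qed.

(** Relativised to a set W of vertices to be dominated, so that the greedy
    choice w, u can be iterated on the set W' of vertices of W not adjacent to
    u: by the choice of u, the neighbourhood of no vertex of W' meets N(w), so
    w can join any open packing inside W'. *)
Lemma open_packing_duality_in (T : finType) (e : rel T) (W : {set T}) :
  symmetric e -> irreflexive e -> acyclic e -> no_isolated_vertex e ->
  exists P D : {set T},
    [/\ P \subset W, open_packing e P,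
        {in W, forall w, exists2 y, y \in D & e w y} & #|D| <= #|P| ].
Proof.
move=> e_sym e_irr acyc noiso.
have [n] := ubnP #|W|; elim: n W => // n IHn W.
have [-> _|Wn0 ltWn] := eqVneq W set0.
  by exists set0, set0; split=> // [p q|w]; rewrite inE.
have [w [u [wW ewu choice]]] :=
  forest_greedy_choice e_sym e_irr acyc noiso Wn0.
pose W' := [set w' in W | ~~ e w' u].
have wW' : w \notin W' by rewrite inE wW ewu.
have W'W : W' \subset W by apply/subsetP=> x; rewrite inE => /andP[].
have ltW' : #|W'| < n.
  rewrite -ltnS; apply: leq_trans ltWn; rewrite ltnS.
  by apply/proper_card/properP; split=> //; exists w.
have [P [D [PW' packP domD leDP]]] := IHn _ ltW'.
have far q x : q \in P -> e w x -> e q x -> False.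
  move=> /(subsetP PW'); rewrite inE => /andP[qW /negP qu] ewx eqx.
  exact/qu/(choice q x).
exists (w |: P), (u |: D); split.
- by rewrite subUset sub1set wW (subset_trans PW').
- move=> p q /setU1P[->|pP] /setU1P[->|qP] // x epx eqx.
  + by case: (far q x).
  + by case: (far p x).
  + exact: packP eqx.
- move=> v vW; have [evu|evuN] := boolP (e v u).
    by exists u; rewrite // setU11.
  have [|y yD evy] := domD v; first by rewrite inE vW.
  by exists y; rewrite // setU1r.
- have wP : w \notin P by apply: contra wW'; apply/subsetP.
  rewrite [leqRHS]cardsU1 wP cardsU1.
  by apply: leq_add leDP; case: (_ \notin _).
Qed.

Lemma open_packing_duality (T : finType) (e : rel T) :
  symmetric e -> irreflexive e -> acyclic e -> no_isolated_vertex e ->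
  exists2 P : {set T}, open_packing e P & gamma_t e <= #|P|.
Proof.
move=> e_sym e_irr acyc noiso.
have [P [D [_ packP domD leDP]]] :=
  open_packing_duality_in [set: T] e_sym e_irr acyc noiso.
exists P => //; apply: leq_trans leDP; apply: gamma_t_le => //.
by apply/total_dominatingP => x; apply: domD.
Qed.

(** * Counting minimum total dominating sets *)

Lemma open_packing_sum_degree (T : finType) (e : rel T) (P : {set T}) :
  open_packing e P -> \sum_(p in P) #|[pred x | e p x]| <= #|T|.
Proof.
move=> packP; under eq_bigr do rewrite -sum1_card.
rewrite (exchange_big_dep predT) //= -sum1_card; apply: leq_sum => x _.
rewrite sum1_card; apply/card_le1_eqP => p q.
by move=> /andP[pP epx] /andP[qP eqx]; apply: (packP q p _ _ x).
Qed.

(** A vertex of D in each N(p), p in P, is recorded as a function that is the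
    identity outside P, so that these functions form a finite family; since
    #|D| <= #|P|, the values of the function on P exhaust D. *)
Lemma num_gamma_t_le_prod_degree (T : finType) (e : rel T) (P : {set T}) :
  open_packing e P -> gamma_t e <= #|P| ->
  num_gamma_t e <= \prod_(p in P) #|[pred x | e p x]|.
Proof.
move=> packP leP.
pose F x : pred T := if x \in P then [pred y | e x y] else pred1 x.
pose pickD (D : {set T}) : {ffun T -> T} :=
  [ffun x => if x \in P then odflt x [pick y in D | e x y] else x].
have pickDP D p : total_dominating e D -> p \in P ->
    (pickD D p \in D) && e p (pickD D p).
  move=> /total_dominatingP tdD pP; rewrite ffunE pP.
  case: pickP => [y //|no]; have [y yD epy] := tdD p.
  by have := no y; rewrite yD epy.
have pickD_im D : min_total_dominating e D -> pickD D @: P = D.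
  case/andP=> tdD /eqP cardD; apply/eqP; rewrite eqEcard cardD.
  have sub : pickD D @: P \subset D.
    by apply/subsetP=> _ /imsetP[p pP ->]; case/andP: (pickDP D p tdD pP).
  rewrite sub card_in_imset // => p q pP qP eqf.
  have /andP[_ epx] := pickDP D p tdD pP.
  have /andP[_ eqx] := pickDP D q tdD qP.
  by apply: (packP p q _ _ (pickD D p)) => //; rewrite eqf.
have -> : \prod_(p in P) #|[pred x | e p x]| = #|family F|.
  rewrite card_family foldrE big_map big_enum /= [RHS](bigID [in P]) /=.
  rewrite [X in _ * X]big1 ?muln1 => [|x xP]; last first.
    by rewrite /F (negbTE xP) card1.
  by apply: eq_bigr => x xP; rewrite /F xP.
rewrite /num_gamma_t -(card_in_imset (f := pickD)); last first.
  move=> D1 D2; rewrite !inE => /pickD_im {2}<- /pickD_im {2}<-.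
  by move=> ->.
apply/subset_leq_card/subsetP=> _ /imsetP[D + ->]; rewrite inE => /andP[tdD _].
apply/familyP=> x; rewrite /F; case: ifPn => xP.
  by have /andP[] := pickDP D x tdD xP.
by rewrite ffunE (negbTE xP) inE.
Qed.

Lemma num_gamma_t_forest_le_pow2 (T : finType) (e : rel T) :
  symmetric e -> irreflexive e -> acyclic e -> no_isolated_vertex e ->
  num_gamma_t e <= 2 ^ (#|T| - gamma_t e).
Proof.
move=> e_sym e_irr acyc noiso.
have [P packP leP] := open_packing_duality e_sym e_irr acyc noiso.
apply: leq_trans (num_gamma_t_le_prod_degree packP leP) _.
have deg_gt0 p : 0 < #|[pred x | e p x]|.
  by have [y epy] := noiso p; apply/card_gt0P; exists y.
apply: (@leq_trans (\prod_(p in P) 2 ^ #|[pred x | e p x]|.-1)).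
  by apply: leq_prod => p _; rewrite -{1}(prednK (deg_gt0 p)) ltn_expl.
rewrite -expn_sum leq_exp2l //.
apply: (@leq_trans (#|T| - #|P|)); last exact: leq_sub2l.
have lePT := max_card P.
rewrite -(leq_add2r #|P|) subnK // -[X in _ + X]sum1_card -big_split /=.
under eq_bigr do rewrite addn1 prednK //.
exact: open_packing_sum_degree.
Qed.

(** * The case gamma_t = n *)

(** Every vertex v has a neighbour u of which v is the only neighbour, because
    the complement of v is not total dominating.  Applied to v and then to u,
    this shows that u is also the only neighbour of v. *)
Lemma gamma_t_full_mate (T : finType) (e : rel T) (v : T) :
  symmetric e -> no_isolated_vertex e -> #|T| <= gamma_t e ->
  exists2 u, e v =1 pred1 u & e u =1 pred1 v.
Proof.
move=> e_sym noiso full.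
have leaf x : exists y, e y =1 pred1 x.
  have : ~~ total_dominating e [set~ x].
    apply: contraTN full => /(gamma_t_le noiso) le; rewrite -ltnNge.
    apply: leq_ltn_trans le _; rewrite cardsC1 prednK //.
    by apply/card_gt0P; exists x.
  rewrite negb_forall => /existsP[y /exists_inPn only].
  have onlyx z : e y z -> z = x.
    by move=> eyz; apply: contraTeq eyz => zx; apply: only; rewrite !inE.
  exists y => z /=; apply/idP/eqP => [/onlyx //|->].
  by have [z' eyz'] := noiso y; rewrite -(onlyx z').
have [u Nu] := leaf v; have [w Nw] := leaf u.
have wv : w = v by apply/eqP; rewrite -[_ == _]Nu e_sym Nw /=.
by exists u => //; rewrite -wv.
Qed.

Lemma components_K2_of_gamma_t_full (T : finType) (e : rel T) :
  symmetric e -> irreflexive e -> no_isolated_vertex e -> #|T| <= gamma_t e ->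
  forall C : {set T}, C \in components e -> induces_complete e 2 C.
Proof.
move=> e_sym e_irr noiso full C /imsetP[x _ defC].
have [y Nx Ny] := gamma_t_full_mate x e_sym noiso full.
have exy : e x y by rewrite Nx /=.
have xy : x != y by apply: contraTneq exy => <-; rewrite e_irr.
have clos : closed e [set x; y].
  apply: intro_closed => [|a b eab]; first exact: sym_connect_sym.
  by move: eab => /[swap] /set2P[] ->; rewrite ?Nx ?Ny /= => /eqP ->;
     rewrite !inE eqxx ?orbT.
have {defC} -> : C = [set x; y].
  rewrite defC; apply/setP=> z; rewrite !inE /=; apply/idP/idP.
    by move/(closed_connect clos); rewrite !inE eqxx /= => <-.
  by case/orP=> /eqP-> //; apply: connect1.
split; first by rewrite cards2 xy.
by move=> a b /set2P[] -> /set2P[] ->; rewrite ?eqxx // e_sym.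
Qed.

Lemma gamma_t_full_of_components_K2 (T : finType) (e : rel T) :
  symmetric e -> irreflexive e -> no_isolated_vertex e ->
  (forall C : {set T}, C \in components e -> induces_complete e 2 C) ->
  gamma_t e = #|T|.
Proof.
move=> e_sym e_irr noiso K2.
have [D /andP[/total_dominatingP tdD /eqP <-]] := gamma_t_attained noiso.
suff -> : D = [set: T] by rewrite cardsT.
apply/setP=> x; rewrite inE.
have [y exy] := noiso x; have [z zD eyz] := tdD y.
pose C := [set w in [set: T] | connect e x w].
have [cardC _] : induces_complete e 2 C by apply/K2/imset_f; rewrite inE.
have yx : y != x by apply: contraTneq exy => ->; rewrite e_irr.
have zy : z != y by apply: contraTneq eyz => ->; rewrite e_irr.
have xyC : [set x; y] \subset C.
  by rewrite subUset !sub1set !inE connect0 connect1.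
have defC : [set x; y] = C.
  by apply/eqP; rewrite eqEcard xyC cardC cards2 eq_sym yx.
have : z \in C.
  by rewrite !inE /=; apply: connect_trans (connect1 exy) (connect1 eyz).
by rewrite -defC => /set2P[<- //|/eqP]; rewrite (negbTE zy).
Qed.

Local Open Scope ring_scope.

Theorem theorem3 (R : rcfType) (T : finType) (e : rel T)
    (e_sym : symmetric e) (e_irr : irreflexive e)
    (T_nonempty : (0 < #|T|)%N)
    (e_forest : acyclic e) (e_noiso : no_isolated_vertex e) :
  (num_gamma_t e)%:R <= (1 + Num.sqrt 2%:R) ^+ (#|T| - gamma_t e)%N :> R
  /\ ((num_gamma_t e)%:R = (1 + Num.sqrt 2%:R) ^+ (#|T| - gamma_t e)%N :> R
      <-> (forall C : {set T}, C \in components e -> induces_complete e 2 C)).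
Proof.
have pow2 := num_gamma_t_forest_le_pow2 e_sym e_irr e_forest e_noiso.
have base_gt2 : 2 < 1 + Num.sqrt 2%:R :> R.
  by rewrite -[ltLHS]/(1 + 1) ltrD2l -[ltLHS]sqrtr1 ltr_sqrt ?ltr0n ?ltr1n.
have base_ge0 : 0 <= 1 + Num.sqrt 2%:R :> R by rewrite addr_ge0 ?sqrtr_ge0.
have pow2R : (num_gamma_t e)%:R <= 2 ^+ (#|T| - gamma_t e) :> R.
  by rewrite -natrX ler_nat.
split; first by apply: le_trans pow2R _; apply: lerXn2r; rewrite ?nnegrE ?ler0n // ltW.
split=> [eqN|K2].
- apply: components_K2_of_gamma_t_full => //; rewrite -subn_eq0.
  apply: contraTT pow2R => n_neq0; rewrite -ltNge eqN ltrXn2r ?nnegrE ?ler0n //.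
- move: pow2; rewrite (gamma_t_full_of_components_K2 e_sym e_irr e_noiso K2).
  rewrite subnn expr0 => le1.
  by apply/eqP; rewrite pnatr_eq1 eqn_leq le1 num_gamma_t_gt0.
Qed.
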